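(* If $A$ is a $\mathbb{C}$-algebra, there are natural (in $A$) isomorphisms of abelian groups $$K_0^n(A)\cong \bigl(K_0(A)\bigr)^{n-1}$$ for all natural numbers $n\geq 2$.
   Context: Convention: algebras have a unit, and algebra homomorphisms are unital, unless stated otherwise. An $n$-potent in a ring $R$ is an element $e$ with $e^n=e$. For a unital ring $R$, let $M_\infty(R)=\bigcup_k M_k(R)$, the direct limit under $a\mapsto \mathrm{diag}(a,0)$, and let $\mathcal{P}^n_\infty(R)$ be the set of $n$-potents in $M_\infty(R)$. For $e,f\in\mathcal{P}^n_\infty(R)$ write $e\sim f$ if, for $k$ large enough that $e,f\in M_k(R)$, there are $a,b\in M_k(R)$ with $e=ab$ and $f=ba$. Let $\mathcal{V}^n(R)$ be the set of equivalence classes, an abelian monoid under $[e]+[f]=[\mathrm{diag}(e,f)]$ with identity $[0]$. The group $K_0^n(R)$ is the Grothendieck completion of $\mathcal{V}^n(R)$. For $n=2$ this is the usual $K_0(R)$ defined by idempotents. A unital ring homomorphism $\alpha:R\to S$ induces $\alpha_*:K_0^n(R)\to K_0^n(S)$, $[(a_{ij})]\mapsto[(\alpha(a_{ij}))]$. *)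

(* Defs.v *)
From HB Require Import structures.
From mathcomp Require Import all_boot all_order all_algebra.
From mathcomp Require Import boolp reals complex.

Set Implicit Arguments.
Unset Strict Implicit.
Unset Printing Implicit Defensive.

Import GRing.Theory.
Local Open Scope ring_scope.
Local Open Scope quotient_scope.

(* MathComp's [algType K] only covers nontrivial rings, and Hierarchy Builder *)
(* does not accept a join of [pzRingType] and [lmodType K] below it; hence a  *)
(* record, so that the zero algebra is not excluded.                          *)
Record unitalAlg (K : pzRingType) := UnitalAlg {
  alg_ring :> pzRingType;
  alg_scale : K -> alg_ring -> alg_ring;
  alg_scaleA : forall c d x,
    alg_scale c (alg_scale d x) = alg_scale (c * d) x;
  alg_scale1 : forall x, alg_scale 1 x = x;
  alg_scaleDr : forall c x y,
    alg_scale c (x + y) = alg_scale c x + alg_scale c y;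
  alg_scaleDl : forall c d x,
    alg_scale (c + d) x = alg_scale c x + alg_scale d x;
  alg_scaleAl : forall c x y, alg_scale c (x * y) = alg_scale c x * y;
  alg_scaleAr : forall c x y, alg_scale c (x * y) = x * alg_scale c y
}.

Definition unitalAlg_of_algType (K : pzRingType) (A : algType K) :
    unitalAlg K :=
  @UnitalAlg K A *:%R (@scalerA K A) (@scale1r K A) (@scalerDr K A)
    (fun c d x => @scalerDl K A x c d) (@scalerAl K A) (@scalerAr K A).

Definition alg_linear (K : pzRingType) (A B : unitalAlg K) (f : A -> B) :=
  forall (c : K) (x : A), f (alg_scale c x) = alg_scale c (f x).

(* Grothendieck completion of a commutative monoid: [(a, b)] stands for the   *)
(* formal difference [a - b].                                                 *)

Section Grothendieck.
Variable M : nmodType.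

Definition groth_rel : rel (M * M) :=
  fun p q => `[< exists u, p.1 + q.2 + u = q.1 + p.2 + u >].

Lemma groth_refl : reflexive groth_rel.
Proof. by move=> p; apply/asboolP; exists 0. Qed.

Lemma groth_sym : symmetric groth_rel.
Proof. by move=> p q; apply/asboolP/asboolP => -[u h]; exists u. Qed.

Lemma groth_trans : transitive groth_rel.
Proof.
move=> [c d] [a b] [e f] /asboolP[u /= hu] /asboolP[v /= hv]; apply/asboolP.
exists (c + d + u + v) => /=.
have -> : a + f + (c + d + u + v) = (a + d + u) + (c + f + v).
  by rewrite (AC (2*4) ((1*4*5)*(3*2*6))).
by rewrite hu hv (AC (3*3) ((4*2)*(1*5*3*6))).
Qed.

Canonical groth_equiv := EquivRel groth_rel groth_refl groth_sym groth_trans.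

Definition groth : Type := {eq_quot groth_equiv}.
HB.instance Definition _ := Choice.on groth.
HB.instance Definition _ := EqQuotient.on groth.

Definition gdiff (a b : M) : groth := \pi_groth (a, b).

Lemma gdiffP (a b c d : M) :
  gdiff a b = gdiff c d <-> exists u, a + d + u = c + b + u.
Proof.
split; first by move=> /eqP; rewrite /gdiff eqmodE => /asboolP.
by move=> h; apply/eqP; rewrite /gdiff eqmodE; apply/asboolP.
Qed.

Lemma gdiff_surj (x : groth) : exists a b, x = gdiff a b.
Proof. by exists (repr x).1, (repr x).2; rewrite /gdiff -surjective_pairing reprK. Qed.

Definition groth_add (x y : groth) : groth :=
  gdiff ((repr x).1 + (repr y).1) ((repr x).2 + (repr y).2).
Definition groth_opp (x : groth) : groth := gdiff (repr x).2 (repr x).1.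

Lemma gdiff_repr a b : exists u,
  (repr (gdiff a b)).1 + b + u = a + (repr (gdiff a b)).2 + u.
Proof.
by apply/gdiffP; rewrite /gdiff -surjective_pairing reprK.
Qed.

Lemma groth_addE a b c d :
  groth_add (gdiff a b) (gdiff c d) = gdiff (a + c) (b + d).
Proof.
apply/gdiffP; have [u hu] := gdiff_repr a b; have [v hv] := gdiff_repr c d.
exists (u + v); move: hu hv.
case: (repr _) => a' b' /= hu; case: (repr _) => c' d' /= hv.
by rewrite [X in X + _]addrACA addrACA hu hv addrACA [X in X + _]addrACA.
Qed.

Lemma groth_oppE a b : groth_opp (gdiff a b) = gdiff b a.
Proof.
apply/gdiffP; have [u hu] := gdiff_repr a b; exists u.
by rewrite (addrC b) hu (addrC a).
Qed.

Lemma groth_addA : associative groth_add.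
Proof.
move=> x y z; have [a [b ->]] := gdiff_surj x.
have [c [d ->]] := gdiff_surj y; have [e [f ->]] := gdiff_surj z.
by rewrite !groth_addE !addrA.
Qed.

Lemma groth_addC : commutative groth_add.
Proof.
by move=> x y; rewrite /groth_add addrC [X in gdiff _ X]addrC.
Qed.

Lemma groth_add0 : left_id (gdiff 0 0) groth_add.
Proof.
by move=> x; have [a [b ->]] := gdiff_surj x; rewrite groth_addE !add0r.
Qed.

Lemma groth_addN : left_inverse (gdiff 0 0) groth_opp groth_add.
Proof.
move=> x; have [a [b ->]] := gdiff_surj x; rewrite groth_oppE groth_addE.
by apply/gdiffP; exists 0; rewrite !addr0 add0r addrC.
Qed.

HB.instance Definition _ := GRing.isZmodule.Build groth
  groth_addA groth_addC groth_add0 groth_addN.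

Lemma gdiffD a b c d : gdiff a b + gdiff c d = gdiff (a + c) (b + d).
Proof. exact: groth_addE. Qed.

Lemma gdiffN a b : - gdiff a b = gdiff b a.
Proof. exact: groth_oppE. Qed.

End Grothendieck.

Section GrothendieckMap.
Variables (M N : nmodType) (h : {additive M -> N}).

Definition groth_map (x : groth M) : groth N :=
  gdiff (h (repr x).1) (h (repr x).2).

Lemma groth_mapE a b : groth_map (gdiff a b) = gdiff (h a) (h b).
Proof.
apply/gdiffP; have [u hu] := gdiff_repr a b; exists (h u).
by rewrite -!raddfD hu.
Qed.

Lemma groth_map_additive : nmod_morphism groth_map.
Proof.
split; first by rewrite groth_mapE !raddf0.
move=> x y; have [a [b ->]] := gdiff_surj x; have [c [d ->]] := gdiff_surj y.
by rewrite gdiffD !groth_mapE gdiffD !raddfD.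
Qed.

HB.instance Definition _ :=
  GRing.isNmodMorphism.Build (groth M) (groth N) groth_map groth_map_additive.

End GrothendieckMap.

(* An element of M_oo(R) is an infinite matrix [nat -> nat -> R] that comes   *)
(* from some 'M[R]_k by extension by 0, so that [a] and [diag(a, 0)] give the *)
(* same element.  The extension is defined for rectangular matrices for use   *)
(* in proofs.                                                                 *)

Section InfiniteMatrices.
Variable R : pzRingType.

Definition mxinf k l (a : 'M[R]_(k, l)) : nat -> nat -> R :=
  fun i j => if (insub i, insub j) is (Some i', Some j') then a i' j' else 0.

Definition truncmx k l (f : nat -> nat -> R) : 'M[R]_(k, l) :=
  \matrix_(i < k, j < l) f i j.

Lemma mxinfE k l (a : 'M[R]_(k, l)) (i : 'I_k) (j : 'I_l) :
  mxinf a i j = a i j.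
Proof. by rewrite /mxinf !valK. Qed.

Lemma mxinf_out k l (a : 'M[R]_(k, l)) i j :
  (k <= i)%N || (l <= j)%N -> mxinf a i j = 0.
Proof.
rewrite /mxinf; case: insubP => // i' hi _; case: insubP => // j' hj _.
by rewrite (leqNgt k) (leqNgt l) hi hj.
Qed.

Lemma mxinfK k l : cancel (@mxinf k l) (@truncmx k l).
Proof. by move=> a; apply/matrixP=> i j; rewrite mxE mxinfE. Qed.

Lemma truncK k l f : (forall i j, (k <= i)%N || (l <= j)%N -> f i j = 0) ->
  mxinf (truncmx k l f) = f.
Proof.
move=> h; apply/funext=> i; apply/funext=> j.
have [out|] := boolP ((k <= i)%N || (l <= j)%N); first by rewrite mxinf_out ?h.
rewrite negb_or -!ltnNge => /andP[hi hj].
by have /= -> := mxinfE (truncmx k l f) (Ordinal hi) (Ordinal hj); rewrite mxE.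
Qed.

Lemma mxinf_trunc k l k' l' (a : 'M[R]_(k, l)) : (k <= k')%N -> (l <= l')%N ->
  mxinf (truncmx k' l' (mxinf a)) = mxinf a.
Proof.
move=> hk hl; apply: truncK => i j /orP[h|h]; apply: mxinf_out.
  by rewrite (leq_trans hk).
by rewrite (leq_trans hl) ?orbT.
Qed.

Lemma truncM k l m k' l' m' (a : 'M[R]_(k, l)) (b : 'M[R]_(l, m)) :
  (l <= l')%N ->
  truncmx k' m' (mxinf (a *m b)) =
  truncmx k' l' (mxinf a) *m truncmx l' m' (mxinf b).
Proof.
move=> hl; apply/matrixP=> i j; rewrite !mxE.
under eq_bigr do rewrite !mxE.
rewrite -(big_mkord predT (fun x => mxinf a i x * mxinf b x j)).
rewrite (big_cat_nat (leq0n l) hl) /= [X in _ + X]big_nat_cond [X in _ + X]big1 ?addr0; last first.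
  by move=> x /andP[/andP[h _] _]; rewrite mxinf_out ?mul0r // h orbT.
rewrite big_mkord.
have [hi|hi] := ltnP i k; last first.
  by rewrite mxinf_out ?hi // big1 // => x _; rewrite mxinf_out ?hi ?mul0r.
have [hj|hj] := ltnP j m; last first.
  rewrite mxinf_out ?hj ?orbT // big1 // => x _.
  by rewrite (@mxinf_out _ _ b) ?hj ?orbT ?mulr0.
have /= -> := mxinfE (a *m b) (Ordinal hi) (Ordinal hj).
rewrite mxE; apply: eq_bigr => x _.
by rewrite -(mxinfE a) -(mxinfE b).
Qed.

End InfiniteMatrices.

Lemma mxinf_map (R S : pzRingType) (f : {rmorphism R -> S}) k l
    (a : 'M[R]_(k, l)) :
  (fun i j => f (mxinf a i j)) = mxinf (map_mx f a).
Proof.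
apply/funext=> i; apply/funext=> j; rewrite /mxinf.
by case: insubP => [i' _ _|_]; rewrite ?rmorph0 //;
   case: insubP => [j' _ _|_]; rewrite ?rmorph0 // mxE.
Qed.

(* The n-potents of M_oo(R).                                                  *)
Record potent (n : nat) (R : pzRingType) := Potent {
  potent_val : nat -> nat -> R;
  potentP : exists k (a : 'M[R]_k), potent_val = mxinf a /\ a ^+ n = a
}.

HB.instance Definition _ n R := gen_eqMixin (potent n R).
HB.instance Definition _ n R := gen_choiceMixin (potent n R).

Section PotentTheory.
Variables (n : nat) (R : pzRingType).
Implicit Types (e f g : potent n R).

Lemma potent_inj : injective (@potent_val n R).
Proof.
by move=> [e he] [f hf] /= h; case: _ / h hf => hf; rewrite (Prop_irrelevance he hf).
Qed.

Definition mkpotent k (a : 'M[R]_k) (ha : a ^+ n = a) : potent n R :=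
  Potent (ex_intro _ k (ex_intro _ a (conj erefl ha))).

Lemma potent_repr e : {k : nat & {a : 'M[R]_k |
  potent_val e = mxinf a /\ a ^+ n = a}}.
Proof. by have [k /cid h] := cid (potentP e); exists k. Qed.

Definition potent_size e : nat := projT1 (potent_repr e).
Definition potent_mx e : 'M[R]_(potent_size e) := sval (projT2 (potent_repr e)).

Lemma potent_mxK e : potent_val e = mxinf (potent_mx e).
Proof. exact: (svalP (projT2 (potent_repr e))).1. Qed.

Lemma potent_mxX e : potent_mx e ^+ n = potent_mx e.
Proof. exact: (svalP (projT2 (potent_repr e))).2. Qed.

Lemma mkpotentK e : mkpotent (potent_mxX e) = e.
Proof. by apply: potent_inj; rewrite /= -potent_mxK. Qed.

(* [e ~ f]: for some [k] with [e], [f] in M_k(R), [e = ab] and [f = ba] with  *)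
(* [a], [b] in M_k(R).                                                        *)
Definition potent_sim e f :=
  exists k (a b : 'M[R]_k),
    potent_val e = mxinf (a *m b) /\ potent_val f = mxinf (b *m a).

End PotentTheory.

Section BlockDiag.
Variables (n : nat) (R : pzRingType).

Definition diagmx k l (a : 'M[R]_k) (b : 'M[R]_l) : 'M[R]_(k + l) :=
  block_mx a 0 0 b.

Lemma diagmxX m k l (a : 'M[R]_k) (b : 'M[R]_l) :
  diagmx a b ^+ m = diagmx (a ^+ m) (b ^+ m).
Proof.
elim: m => [|m IHm]; first by rewrite !expr0 /diagmx -scalar_mx_block.
rewrite !exprS IHm -!mulmxE /diagmx mulmx_block.
by rewrite !mulmx0 !mul0mx !addr0 !add0r.
Qed.

Lemma diagmx_potent k l (a : 'M[R]_k) (b : 'M[R]_l) :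
  a ^+ n = a -> b ^+ n = b -> diagmx a b ^+ n = diagmx a b.
Proof. by move=> ha hb; rewrite diagmxX ha hb. Qed.

(* diag(e, f), formed with some sizes [k], [l] such that [e] and [f] lie in   *)
(* M_k(R) and M_l(R); by [Vclass_diag] below the choice of sizes does not     *)
(* affect the class.                                                          *)
Definition potent_diag (e f : potent n R) : potent n R :=
  mkpotent (diagmx_potent (potent_mxX e) (potent_mxX f)).

End BlockDiag.

Section Similarity.
Variables (n : nat) (hn : (2 <= n)%N) (R : pzRingType).
Implicit Types (e f g : potent n R).

(* rectangular version of [potent_sim]                                        *)
Definition mx_sim k l (a : 'M[R]_k) (b : 'M[R]_l) :=
  exists (u : 'M[R]_(k, l)) (v : 'M[R]_(l, k)), a = u *m v /\ b = v *m u.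

Let exprS2 k (a : 'M[R]_k) : a ^+ n = a *m a ^+ n.-2 *m a.
Proof.
case: n hn => [|[|m]] // _; rewrite /= !mulmxE -exprS.
by rewrite -exprSr.
Qed.

Lemma mulmxXC k l (u : 'M[R]_(k, l)) (v : 'M[R]_(l, k)) m :
  (u *m v) ^+ m *m u = u *m (v *m u) ^+ m.
Proof.
elim: m => [|m IHm]; first by rewrite !expr0 mul1mx mulmx1.
by rewrite !exprSr -!mulmxE !mulmxA IHm.
Qed.

Lemma mx_sim_refl k (a : 'M[R]_k) : a ^+ n = a -> mx_sim a a.
Proof.
move=> ha; exists (a ^+ n.-1), a; rewrite !mulmxE -exprSr -exprS.
by rewrite prednK ?ha // (leq_trans _ hn).
Qed.

Lemma mx_sim_sym k l (a : 'M[R]_k) (b : 'M[R]_l) : mx_sim a b -> mx_sim b a.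
Proof. by move=> [u [v [-> ->]]]; exists v, u. Qed.

Lemma mx_sim_trans k l m (a : 'M[R]_k) (b : 'M[R]_l) (c : 'M[R]_m) :
  a ^+ n = a -> c ^+ n = c -> mx_sim a b -> mx_sim b c -> mx_sim a c.
Proof.
move=> ha hc [u [v [ea eb]]] [x [y [eb' ec]]].
exists (u *m x), (y *m v *m a ^+ n.-2); split.
  have -> : u *m x *m (y *m v *m a ^+ n.-2) = u *m (x *m y) *m v *m a ^+ n.-2.
    by rewrite !mulmxA.
  rewrite -eb' eb (_ : u *m _ *m v = a *m a); last by rewrite ea !mulmxA.
  rewrite -{1}ha exprS2 -mulmxA !mulmxE -exprSr -!exprS.
  by rewrite -mulrA -!exprS.
have H1 p : a ^+ p *m u = u *m b ^+ p by rewrite ea eb mulmxXC.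
have H2 p : b ^+ p *m x = x *m c ^+ p by rewrite eb' ec mulmxXC.
rewrite -!mulmxA (mulmxA _ u) H1 -mulmxA H2 (mulmxA v) -eb !mulmxA.
have -> : y *m b *m x = c *m c by rewrite eb' ec !mulmxA.
by rewrite -[LHS]hc exprS2 !mulmxE -!mulrA -exprSr -[in RHS]exprS.
Qed.

(* a potent and its extension by zero *)
Lemma mx_sim_trunc k m (a : 'M[R]_k) : (k <= m)%N -> a ^+ n = a ->
  mx_sim a (truncmx m m (mxinf a)).
Proof.
move=> hk ha; exists (truncmx k m (mxinf (a ^+ n.-1))), (truncmx m k (mxinf a)).
rewrite -!truncM // !mulmxE -exprSr -exprS prednK ?ha ?mxinfK //.
by rewrite (leq_trans _ hn).
Qed.

Lemma truncX k m (a : 'M[R]_k) : (k <= m)%N -> a ^+ n = a ->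
  truncmx m m (mxinf a) ^+ n = truncmx m m (mxinf a).
Proof.
move=> hk ha.
have H p : truncmx m m (mxinf a) ^+ p.+1 = truncmx m m (mxinf (a ^+ p.+1)).
  elim: p => [|p IHp]; first by rewrite !expr1.
  by rewrite exprS IHp -mulmxE -truncM // mulmxE -exprS.
by rewrite -{2}ha -(ltn_predK hn) H.
Qed.

Lemma mx_sim_eq_mxinf k l (a : 'M[R]_k) (b : 'M[R]_l) :
  a ^+ n = a -> b ^+ n = b -> mxinf a = mxinf b -> mx_sim a b.
Proof.
move=> ha hb hab; apply: (@mx_sim_trans _ _ _ _ (truncmx (maxn k l) (maxn k l) (mxinf a))) => //.
  by apply: mx_sim_trunc; rewrite ?leq_maxl.
by rewrite hab; apply/mx_sim_sym/mx_sim_trunc; rewrite ?leq_maxr.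
Qed.

Lemma potent_simP k l (a : 'M[R]_k) (b : 'M[R]_l) (ha : a ^+ n = a)
    (hb : b ^+ n = b) :
  potent_sim (mkpotent ha) (mkpotent hb) <-> mx_sim a b.
Proof.
split=> [[m [u [v /= [ea eb]]]]|[u [v [ea eb]]]]; last first.
  exists (maxn k l), (truncmx _ _ (mxinf u)), (truncmx _ _ (mxinf v)).
  have hk : (k <= maxn k l)%N := leq_maxl _ _.
  have hl : (l <= maxn k l)%N := leq_maxr _ _.
  by rewrite -!truncM // -ea -eb !mxinf_trunc.
pose M := maxn m (maxn k l).
have hm : (m <= M)%N by rewrite leq_max leqnn.
have hk : (k <= M)%N by rewrite !leq_max leqnn orbT.
have hl : (l <= M)%N by rewrite !leq_max leqnn !orbT.
have ta := truncX hk ha; have tb := truncX hl hb.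
apply: (mx_sim_trans ha hb (mx_sim_trunc hk ha)).
apply: (mx_sim_trans ta hb); last exact: (mx_sim_sym (mx_sim_trunc hl hb)).
exists (truncmx M M (mxinf u)), (truncmx M M (mxinf v)).
by rewrite ea eb !(truncM _ _ _ _ hm).
Qed.

Lemma potent_sim_mx e f :
  potent_sim e f <-> mx_sim (potent_mx e) (potent_mx f).
Proof. by rewrite -{1}(mkpotentK e) -{1}(mkpotentK f); exact: potent_simP. Qed.

Lemma mx_sim_diag k l k' l' (a : 'M[R]_k) (b : 'M[R]_l) (a' : 'M[R]_k')
    (b' : 'M[R]_l') :
  mx_sim a a' -> mx_sim b b' -> mx_sim (diagmx a b) (diagmx a' b').
Proof.
move=> [u [v [-> ->]]] [x [y [-> ->]]].
exists (block_mx u 0 0 x), (block_mx v 0 0 y).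
by rewrite /diagmx !mulmx_block !mulmx0 !mul0mx !addr0 !add0r.
Qed.

Lemma mx_sim_diagC k l (a : 'M[R]_k) (b : 'M[R]_l) :
  mx_sim (diagmx a b) (diagmx b a).
Proof.
exists (block_mx 0 a b 0), (block_mx 0 1%:M 1%:M 0).
by rewrite /diagmx !mulmx_block !mulmx0 !mul0mx !mulmx1 !mul1mx !addr0 !add0r.
Qed.

Lemma mxinf_cast k k' l l' (e : (k = k') * (l = l')) (a : 'M[R]_(k, l)) :
  mxinf (castmx e a) = mxinf a.
Proof. by case: e => e1 e2; case: _ / e1; case: _ / e2. Qed.

Lemma mxinf_diagA k l m (a : 'M[R]_k) (b : 'M[R]_l) (c : 'M[R]_m) :
  mxinf (diagmx a (diagmx b c)) = mxinf (diagmx (diagmx a b) c).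
Proof.
rewrite /diagmx -[X in block_mx a X _ _](@row_mx0 R k l m).
by rewrite -[X in block_mx a _ X _](@col_mx0 R l m k) block_mxA mxinf_cast
           row_mx0 col_mx0.
Qed.

End Similarity.

(* The monoid V^n(R).  For [n < 2] the relation need not be transitive, hence *)
(* the hypothesis [2 <= n] as a parameter.                                    *)

Section VMonoid.
Variables (n : nat) (hn : (2 <= n)%N) (R : pzRingType).

Definition potent_rel of (2 <= n)%N : rel (potent n R) :=
  fun e f => `[< potent_sim e f >].

Lemma potent_rel_refl : reflexive (potent_rel hn).
Proof.
by move=> e; apply/asboolP/(potent_sim_mx hn)/(mx_sim_refl hn)/potent_mxX.
Qed.

Lemma potent_rel_sym : symmetric (potent_rel hn).
Proof.
by move=> e f; apply/asboolP/asboolP => -[k [a [b [? ?]]]]; exists k, b, a.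
Qed.

Lemma potent_rel_trans : transitive (potent_rel hn).
Proof.
move=> f e g /asboolP/(potent_sim_mx hn) h /asboolP/(potent_sim_mx hn) h'.
apply/asboolP/(potent_sim_mx hn).
by apply: (mx_sim_trans hn _ _ h h'); apply: potent_mxX.
Qed.

Canonical potent_equiv :=
  EquivRel (potent_rel hn) potent_rel_refl potent_rel_sym potent_rel_trans.

Definition Vn : Type := {eq_quot potent_equiv}.
HB.instance Definition _ := Choice.on Vn.
HB.instance Definition _ := EqQuotient.on Vn.

Definition Vclass (e : potent n R) : Vn := \pi_Vn e.

Lemma VclassP e f : Vclass e = Vclass f <-> potent_sim e f.
Proof.
split; first by move=> /eqP; rewrite /Vclass eqmodE => /asboolP.
by move=> h; apply/eqP; rewrite /Vclass eqmodE; apply/asboolP.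
Qed.

Lemma Vclass_mxP k l (a : 'M[R]_k) (b : 'M[R]_l) (ha : a ^+ n = a)
    (hb : b ^+ n = b) :
  Vclass (mkpotent ha) = Vclass (mkpotent hb) <-> mx_sim a b.
Proof. by rewrite VclassP; exact: potent_simP. Qed.

Lemma Vclass_surj (x : Vn) :
  exists k (a : 'M[R]_k) (ha : a ^+ n = a), x = Vclass (mkpotent ha).
Proof.
exists _, _, (potent_mxX (repr x)).
by rewrite mkpotentK /Vclass reprK.
Qed.

Lemma mx0_potent : (0 : 'M[R]_0) ^+ n = 0.
Proof. by rewrite expr0n -(ltn_predK hn). Qed.

Definition V_add (x y : Vn) : Vn := Vclass (potent_diag (repr x) (repr y)).
Definition V_zero : Vn := Vclass (mkpotent mx0_potent).

Lemma Vclass_repr k (a : 'M[R]_k) (ha : a ^+ n = a) :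
  mx_sim (potent_mx (repr (Vclass (mkpotent ha)))) a.
Proof.
apply/(potent_simP hn (potent_mxX _) ha)/VclassP.
by rewrite mkpotentK /Vclass reprK.
Qed.

Lemma Vclass_diag k l (a : 'M[R]_k) (b : 'M[R]_l) (ha : a ^+ n = a)
    (hb : b ^+ n = b) :
  V_add (Vclass (mkpotent ha)) (Vclass (mkpotent hb)) =
  Vclass (mkpotent (diagmx_potent ha hb)).
Proof. by apply/Vclass_mxP/mx_sim_diag; exact: Vclass_repr. Qed.

Lemma V_addA : associative V_add.
Proof.
move=> x y z; have [k [a [ha ->]]] := Vclass_surj x.
have [l [b [hb ->]]] := Vclass_surj y; have [m [c [hc ->]]] := Vclass_surj z.
rewrite !Vclass_diag; congr Vclass; apply: potent_inj => /=.
exact: mxinf_diagA.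
Qed.

Lemma V_addC : commutative V_add.
Proof.
move=> x y; have [k [a [ha ->]]] := Vclass_surj x.
have [l [b [hb ->]]] := Vclass_surj y; rewrite !Vclass_diag.
exact/Vclass_mxP/mx_sim_diagC.
Qed.

Lemma V_add0 : left_id V_zero V_add.
Proof.
move=> x; have [k [a [ha ->]]] := Vclass_surj x; rewrite Vclass_diag.
congr Vclass; apply: potent_inj => /=; congr mxinf.
apply/matrixP=> i j.
case: (split_ordP i) => [[]//|i' ->]; case: (split_ordP j) => [[]//|j' ->].
by rewrite /diagmx block_mxEdr; congr (a _ _); apply/val_inj.
Qed.

HB.instance Definition _ := GRing.isNmodule.Build Vn V_addA V_addC V_add0.

Lemma VclassD k l (a : 'M[R]_k) (b : 'M[R]_l) (ha : a ^+ n = a)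
    (hb : b ^+ n = b) :
  Vclass (mkpotent ha) + Vclass (mkpotent hb) =
  Vclass (mkpotent (diagmx_potent ha hb)).
Proof. exact: Vclass_diag. Qed.

End VMonoid.

Section VMap.
Variables (n : nat) (hn : (2 <= n)%N) (R S : pzRingType).
Variable f : {rmorphism R -> S}.

Lemma map_mxX_pz k (a : 'M[R]_k) m : map_mx f (a ^+ m) = map_mx f a ^+ m.
Proof.
elim: m => [|m IHm]; first by rewrite !expr0 map_mx1.
by rewrite !exprS -!mulmxE map_mxM IHm.
Qed.

Lemma map_potent_subproof (e : potent n R) :
  exists k (a : 'M[S]_k),
    (fun i j => f (potent_val e i j)) = mxinf a /\ a ^+ n = a.
Proof.
have [k [a [-> ha]]] := potentP e; exists k, (map_mx f a).
by rewrite mxinf_map -map_mxX_pz ha.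
Qed.

Definition map_potent (e : potent n R) : potent n S :=
  Potent (map_potent_subproof e).

Lemma map_potent_sim e e' :
  potent_sim e e' -> potent_sim (map_potent e) (map_potent e').
Proof.
move=> [k [a [b [ea eb]]]]; exists k, (map_mx f a), (map_mx f b).
by rewrite /= ea eb !mxinf_map !map_mxM.
Qed.

Definition V_map (x : Vn hn R) : Vn hn S := Vclass hn (map_potent (repr x)).

Lemma V_mapE e : V_map (Vclass hn e) = Vclass hn (map_potent e).
Proof. by apply/VclassP/map_potent_sim/(VclassP hn); rewrite /Vclass reprK. Qed.

Lemma map_mx_potent k (a : 'M[R]_k) :
  a ^+ n = a -> map_mx f a ^+ n = map_mx f a.
Proof. by move=> ha; rewrite -map_mxX_pz ha. Qed.

Lemma V_map_mxE k (a : 'M[R]_k) (ha : a ^+ n = a) :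
  V_map (Vclass hn (mkpotent ha)) = Vclass hn (mkpotent (map_mx_potent ha)).
Proof.
by rewrite V_mapE; congr Vclass; apply: potent_inj; rewrite /= mxinf_map.
Qed.

Lemma V_map_additive : nmod_morphism V_map.
Proof.
split.
  rewrite /GRing.zero /= /V_zero V_map_mxE; congr Vclass.
  by apply: potent_inj; rewrite /= map_mx0.
move=> x y; have [k [a [ha ->]]] := Vclass_surj x.
have [l [b [hb ->]]] := Vclass_surj y.
rewrite VclassD !V_map_mxE VclassD; congr Vclass; apply: potent_inj => /=.
by rewrite /diagmx map_block_mx !map_mx0.
Qed.

HB.instance Definition _ :=
  GRing.isNmodMorphism.Build (Vn hn R) (Vn hn S) V_map V_map_additive.

End VMap.

Definition K0n (n : nat) (hn : (2 <= n)%N) (R : pzRingType) : zmodType :=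
  groth (Vn hn R).

Definition K0n_map (n : nat) (hn : (2 <= n)%N) (R S : pzRingType)
    (f : {rmorphism R -> S}) : {additive K0n hn R -> K0n hn S} :=
  groth_map (@V_map n hn R S f).

Definition K0 (R : pzRingType) : zmodType := K0n (leqnn 2) R.

Definition K0_map (R S : pzRingType) (f : {rmorphism R -> S}) :
    {additive K0 R -> K0 S} :=
  K0n_map (leqnn 2) f.

(* Main.v *)
Require Import Defs.
From HB Require Import structures.
From mathcomp Require Import all_boot all_order all_algebra.
From mathcomp Require Import cyclic separable cyclotomic.
From mathcomp Require Import boolp reals complex.

Set Implicit Arguments.
Unset Strict Implicit.
Unset Printing Implicit Defensive.

Import GRing.Theory.
Local Open Scope ring_scope.

(** Put N = n - 1 and let w be a primitive N-th root of unity in the base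
field K.  A matrix e with e ^+ n = e is a root of 'X * ('X^N - 1), which has
simple roots 0, 1, w, ..., w ^+ N.-1, so e decomposes as
e = \sum_i w ^+ i e_i, where e_i, the value at e of the Lagrange polynomial
  N^-1 * \sum_(1 <= j <= N) w^-(i j) 'X^j,
is the idempotent projecting onto the w ^+ i-eigenspace and the e_i are
mutually orthogonal.  These polynomials have no constant term.  This makes e_i
compatible with the inclusion of matrices by zero extension, and also gives
invariance under similarity: if e = uv and f = vu then e_i = u (q(f) v) and
f_i = (q(f) v) u, where q is the Lagrange polynomial divided by 'X.

The isomorphism sends [e] to ([e_i])_i; its inverse sends a family ([f_i])_i
of idempotent classes to \sum_i [w ^+ i f_i].  One composite is the identity
because the j-th projection of w ^+ i f is f if i = j and 0 otherwise
([V_specproj_scale]); the other because a sum of orthogonal potents has the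
class of their direct sum ([Vclass_orth_sum]), which applies to
e = \sum_i w ^+ i e_i ([V_scale_specproj_sum]).  Both identities hold already
in the monoids V^n(A) and V^2(A), and pass to Grothendieck groups.  Everything
is given by polynomials with coefficients in K, hence is natural in A.

The decomposition is established over any field K containing a primitive N-th
root of unity; the complex numbers contain one, being algebraically closed of
characteristic 0. *)

(** * Operations on potents and the maps they induce *)

(** The size-indexed families of matrix functions that induce additive maps
V^n(R) -> V^m(S).  Invariance under similarity includes invariance under zero
extension, since a potent is similar to its extensions by zero. *)
Record potentOp (n m : nat) (R S : pzRingType) := PotentOp {
  op_mx :> forall k, 'M[R]_k -> 'M[S]_k;
  op_potent : forall k (a : 'M[R]_k), a ^+ n = a -> op_mx a ^+ m = op_mx a;
  op_sim : forall k l (a : 'M[R]_k) (b : 'M[R]_l),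
    mx_sim a b -> mx_sim (op_mx a) (op_mx b);
  op_diag : forall k l (a : 'M[R]_k) (b : 'M[R]_l),
    op_mx (diagmx a b) = diagmx (op_mx a) (op_mx b)
}.

Lemma Vclass_congr n (hn : (2 <= n)%N) (R : pzRingType) k (a b : 'M[R]_k)
    (ha : a ^+ n = a) (hb : b ^+ n = b) :
  a = b -> Vclass hn (mkpotent ha) = Vclass hn (mkpotent hb).
Proof. by move=> ab; congr Vclass; apply: potent_inj; rewrite /= ab. Qed.

Lemma Vclass0 n (hn : (2 <= n)%N) (R : pzRingType) k (a : 'M[R]_k)
    (ha : a ^+ n = a) :
  a = 0 -> Vclass hn (mkpotent ha) = 0.
Proof.
move=> a0; apply/Vclass_mxP; exists 0, 0.
by rewrite !mulmx0.
Qed.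

Section InducedMap.
Variables (n m : nat) (hn : (2 <= n)%N) (hm : (2 <= m)%N) (R S : pzRingType).
Variable F : potentOp n m R S.

Definition V_op (x : Vn hn R) : Vn hm S :=
  Vclass hm (mkpotent (op_potent F (potent_mxX (repr x)))).

Lemma V_opE k (a : 'M[R]_k) (ha : a ^+ n = a) :
  V_op (Vclass hn (mkpotent ha)) = Vclass hm (mkpotent (op_potent F ha)).
Proof. exact/Vclass_mxP/op_sim/Vclass_repr. Qed.

Lemma V_op_additive : nmod_morphism V_op.
Proof.
split.
  rewrite {1}/GRing.zero /= /V_zero V_opE.
  by apply: Vclass0; apply/matrixP => -[].
move=> x y; have [k [a [ha ->]]] := Vclass_surj x.
have [l [b [hb ->]]] := Vclass_surj y.
rewrite VclassD !V_opE VclassD; exact/Vclass_congr/op_diag.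
Qed.

HB.instance Definition _ :=
  GRing.isNmodMorphism.Build (Vn hn R) (Vn hm S) V_op V_op_additive.

End InducedMap.

Lemma V_map_op n m (hn : (2 <= n)%N) (hm : (2 <= m)%N) (R R' S S' : pzRingType)
    (F : potentOp n m R S) (F' : potentOp n m R' S')
    (f : {rmorphism R -> R'}) (g : {rmorphism S -> S'}) :
  (forall k (a : 'M[R]_k), map_mx g (F k a) = F' k (map_mx f a)) ->
  forall x : Vn hn R, V_map g (V_op hm F x) = V_op hm F' (V_map f x).
Proof.
move=> Ffg x; have [k [a [ha ->]]] := Vclass_surj x.
by rewrite V_opE !V_map_mxE V_opE; apply: Vclass_congr.
Qed.

(** * Sums of orthogonal potents *)

Section OrthogonalSums.
Variables (n : nat) (hn : (2 <= n)%N) (R : pzRingType).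

Lemma exprD_orth k (a b : 'M[R]_k) m :
  a *m b = 0 -> b *m a = 0 -> (a + b) ^+ m.+1 = a ^+ m.+1 + b ^+ m.+1.
Proof.
rewrite !mulmxE => ab ba; elim: m => // m IHm.
have aX : a * b ^+ m.+1 = 0 by rewrite exprS mulrA ab mul0r.
have bX : b * a ^+ m.+1 = 0 by rewrite exprS mulrA ba mul0r.
by rewrite exprS IHm mulrDl !mulrDr aX bX addr0 add0r -!exprS.
Qed.

(** With x = a ^+ n.-1 and y = b ^+ n.-1, the product of the row (x, y) and the
column (a, b) is a + b, while the product in the other order is diag(a, b): its
off-diagonal entries a y and b x vanish as n.-1 > 0. *)
Lemma Vclass_orthD k (a b : 'M[R]_k) (ha : a ^+ n = a) (hb : b ^+ n = b)
    (hab : (a + b) ^+ n = a + b) :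
  a *m b = 0 -> b *m a = 0 ->
  Vclass hn (mkpotent hab) =
  Vclass hn (mkpotent ha) + Vclass hn (mkpotent hb).
Proof.
move=> ab ba; rewrite VclassD; apply/Vclass_mxP.
have hn' : n = n.-2.+2 by case: n hn => [|[]].
have pow (c : 'M[R]_k) : c ^+ n = c -> c *m c ^+ n.-1 = c /\ c ^+ n.-1 *m c = c.
  by move=> hc; rewrite !mulmxE -exprS -exprSr prednK ?hc // (ltnW hn).
have [[aa aa'] [bb bb']] := (pow a ha, pow b hb).
exists (row_mx (a ^+ n.-1) (b ^+ n.-1)), (col_mx a b); split.
  by rewrite mul_row_col aa' bb'.
rewrite mul_col_row aa bb /diagmx hn' /= !exprS -!mulmxE !mulmxA ab ba.
by rewrite !mul0mx.
Qed.

Lemma Vclass_orth_sum (I : eqType) (s : seq I) k (a : I -> 'M[R]_k)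
    (ha : forall i, a i ^+ n = a i)
    (hs : (\sum_(i <- s) a i) ^+ n = \sum_(i <- s) a i) :
  uniq s -> (forall i j, i != j -> a i *m a j = 0) ->
  Vclass hn (mkpotent hs) = \sum_(i <- s) Vclass hn (mkpotent (ha i)).
Proof.
move=> us orth; elim: s us hs => [_ hs | i s IHs /= /andP[i_s us] hs].
  by rewrite [RHS]big_nil; apply: Vclass0; exact: big_nil.
have orthl : a i *m (\sum_(j <- s) a j) = 0.
  rewrite mulmx_sumr big1_seq // => j /= js; apply: orth.
  by apply: contraNneq i_s => ->.
have orthr : (\sum_(j <- s) a j) *m a i = 0.
  rewrite mulmx_suml big1_seq // => j /= js; apply: orth.
  by apply: contraNneq i_s => <-.
have hs2 : (a i + \sum_(j <- s) a j) ^+ n = a i + \sum_(j <- s) a j.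
  by move: (hs); rewrite big_cons.
have hs' : (\sum_(j <- s) a j) ^+ n = \sum_(j <- s) a j.
  have n0 : n = n.-1.+1 by rewrite (ltn_predK hn).
  by move: hs2; rewrite {1}n0 exprD_orth // -n0 ha => /addrI.
rewrite [RHS]big_cons -(IHs us hs') -(Vclass_orthD (ha i) hs' hs2) //.
by apply: Vclass_congr; exact: big_cons.
Qed.

End OrthogonalSums.

(** * Scaling of matrices over an algebra *)

Lemma idem_expS (R : pzRingType) (f : R) m : f ^+ 2 = f -> f ^+ m.+1 = f.
Proof. by move=> ff; elim: m => // m IHm; rewrite exprS IHm -expr2. Qed.

Section ScalarAction.
Variables (K : pzRingType) (A : unitalAlg K).
Implicit Types (c d : K).

Definition mxscale k l c (a : 'M[A]_(k, l)) : 'M[A]_(k, l) :=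
  map_mx (alg_scale c) a.

Lemma alg_scale0 c : alg_scale c (0 : A) = 0.
Proof. by apply: (addrI (alg_scale c 0)); rewrite -alg_scaleDr !addr0. Qed.

Lemma mxscaleDr k l c (a b : 'M[A]_(k, l)) :
  mxscale c (a + b) = mxscale c a + mxscale c b.
Proof. by apply/matrixP => i j; rewrite !mxE alg_scaleDr. Qed.

Lemma mxscale0 k l c : mxscale c (0 : 'M[A]_(k, l)) = 0.
Proof. by apply/matrixP => i j; rewrite !mxE alg_scale0. Qed.

HB.instance Definition _ k l c := GRing.isNmodMorphism.Build
  'M[A]_(k, l) 'M[A]_(k, l) (@mxscale k l c)
  (conj (mxscale0 k l c) (@mxscaleDr k l c)).

Lemma mxscaleDl k l c d (a : 'M[A]_(k, l)) :
  mxscale (c + d) a = mxscale c a + mxscale d a.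
Proof. by apply/matrixP => i j; rewrite !mxE alg_scaleDl. Qed.

Lemma mxscale0l k l (a : 'M[A]_(k, l)) : mxscale 0 a = 0.
Proof. by apply: (addrI (mxscale 0 a)); rewrite -mxscaleDl !addr0. Qed.

Lemma mxscale_suml k l (I : Type) (s : seq I) (c : I -> K) (a : 'M[A]_(k, l)) :
  mxscale (\sum_(i <- s) c i) a = \sum_(i <- s) mxscale (c i) a.
Proof.
pose scale_by d := mxscale d a.
apply: (big_morph scale_by) => [d e|]; first exact: mxscaleDl.
exact: mxscale0l.
Qed.

Lemma mxscaleA k l c d (a : 'M[A]_(k, l)) :
  mxscale c (mxscale d a) = mxscale (c * d) a.
Proof. by apply/matrixP => i j; rewrite !mxE alg_scaleA. Qed.

Lemma mxscale1 k l (a : 'M[A]_(k, l)) : mxscale 1 a = a.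
Proof. by apply/matrixP => i j; rewrite !mxE alg_scale1. Qed.

Lemma alg_scale_sum (I : Type) (s : seq I) c (x : I -> A) :
  alg_scale c (\sum_(i <- s) x i) = \sum_(i <- s) alg_scale c (x i).
Proof. exact: (big_morph _ (alg_scaleDr c) (alg_scale0 c)). Qed.

Lemma mxscaleMl k l m c (a : 'M[A]_(k, l)) (b : 'M[A]_(l, m)) :
  mxscale c a *m b = mxscale c (a *m b).
Proof.
apply/matrixP => i j; rewrite !mxE alg_scale_sum.
by apply: eq_bigr => x _; rewrite mxE alg_scaleAl.
Qed.

Lemma mxscaleMr k l m c (a : 'M[A]_(k, l)) (b : 'M[A]_(l, m)) :
  a *m mxscale c b = mxscale c (a *m b).
Proof.
apply/matrixP => i j; rewrite !mxE alg_scale_sum.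
by apply: eq_bigr => x _; rewrite mxE alg_scaleAr.
Qed.

Lemma mxscale_exp k c (a : 'M[A]_k) m :
  mxscale c a ^+ m = mxscale (c ^+ m) (a ^+ m).
Proof.
elim: m => [|m IHm]; first by rewrite !expr0 mxscale1.
by rewrite !exprS IHm -!mulmxE mxscaleMl mxscaleMr mxscaleA.
Qed.

Lemma mxscale_diag k l c (a : 'M[A]_k) (b : 'M[A]_l) :
  mxscale c (diagmx a b) = diagmx (mxscale c a) (mxscale c b).
Proof. by rewrite /mxscale /diagmx map_block_mx -!/(mxscale _ _) !mxscale0. Qed.

Lemma diagmx_sum (I : Type) (s : seq I) k l (a : I -> 'M[A]_k)
    (b : I -> 'M[A]_l) :
  \sum_(i <- s) diagmx (a i) (b i) =
  diagmx (\sum_(i <- s) a i) (\sum_(i <- s) b i).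
Proof.
elim: s => [|i s IHs]; first by rewrite !big_nil /diagmx block_mx0.
by rewrite !big_cons IHs /diagmx add_block_mx !addr0.
Qed.

End ScalarAction.

Lemma map_mxscale (K : pzRingType) (A B : unitalAlg K) (f : {rmorphism A -> B})
    k l c (a : 'M[A]_(k, l)) :
  alg_linear f -> map_mx f (mxscale c a) = mxscale c (map_mx f a).
Proof. by move=> fl; apply/matrixP => i j; rewrite !mxE fl. Qed.

(** * Spectral projections of a potent matrix *)

Lemma sum_expr_unity_root (K : fieldType) (N : nat) (z : K) :
  z ^+ N = 1 -> z != 1 -> \sum_(j < N) z ^+ j = 0.
Proof.
move=> zN z1; apply/eqP; have /eqP := subrX1 z N.
by rewrite zN subrr eq_sym mulf_eq0 subr_eq0 (negPf z1).
Qed.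

Section SpectralProjection.
Variables (K : fieldType) (A : unitalAlg K) (N : nat).
Hypothesis N_neq0 : N%:R != 0 :> K.
Implicit Types (z w : K).

(** For z an N-th root of unity, the Lagrange polynomial of the node z among
the roots of 'X * ('X^N - 1), evaluated at a. *)
Definition specproj z k (a : 'M[A]_k) : 'M[A]_k :=
  \sum_(j < N) mxscale (N%:R^-1 * z ^- j.+1) (a ^+ j.+1).

Lemma unity_root_neq0 z : z ^+ N = 1 -> z != 0.
Proof.
move=> zN; apply: contraTneq (oner_neq0 K) => z0.
have N0 : N != 0 by apply: contraNneq N_neq0 => ->.
by rewrite -zN z0 expr0n (negPf N0) eqxx.
Qed.

(** Multiplying by a shifts the powers of a in the sum by one; as
a ^+ N.+1 = a and z ^+ N = 1, the shift is cyclic. *)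
Lemma specproj_mul z k (a : 'M[A]_k) :
  z ^+ N = 1 -> a ^+ N.+1 = a ->
  a *m specproj z a = mxscale z (specproj z a).
Proof.
move=> zN aN; have z0 := unity_root_neq0 zN.
pose G j := mxscale (N%:R^-1 * z ^- j) (a ^+ j.+1).
have -> : a *m specproj z a = \sum_(j < N) G j.+1.
  rewrite mulmx_sumr; apply: eq_bigr => j _.
  by rewrite mxscaleMr mulmxE -exprS.
have -> : mxscale z (specproj z a) = \sum_(j < N) G j.
  rewrite raddf_sum; apply: eq_bigr => j _; rewrite /= mxscaleA /G.
  by rewrite [z ^+ _]exprS invfM mulrCA mulVKf.
apply: (addrI (G 0)); rewrite -(big_ord_recl N G) big_ord_recr /= addrC.
by congr (_ + _); rewrite /G zN aN expr0 expr1.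
Qed.

Lemma specproj_expmul z k (a : 'M[A]_k) m : z ^+ N = 1 -> a ^+ N.+1 = a ->
  a ^+ m *m specproj z a = mxscale (z ^+ m) (specproj z a).
Proof.
move=> zN aN; elim: m => [|m IHm]; first by rewrite !expr0 mul1mx mxscale1.
rewrite !exprS -mulmxE -mulmxA IHm mxscaleMr specproj_mul // mxscaleA.
by rewrite mulrC.
Qed.

(** The Lagrange polynomial of the node w takes the value (z == w) at the node
z: this is orthogonality of the characters of a cyclic group. *)
Lemma specproj_coef z w : z ^+ N = 1 -> w ^+ N = 1 ->
  \sum_(j < N) N%:R^-1 * w ^- j.+1 * z ^+ j.+1 = (z == w)%:R.
Proof.
move=> zN wN; have w0 := unity_root_neq0 wN.
under eq_bigr do rewrite -mulrA [_ ^- _ * _]mulrC -expr_div_n exprS.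
rewrite -mulr_sumr -mulr_sumr; have [<-|zw] := eqVneq z w.
  rewrite divff ?unity_root_neq0 //.
  under eq_bigr do rewrite expr1n.
  by rewrite sumr_const card_ord mul1r mulVf.
rewrite sum_expr_unity_root ?mulr0 //.
  by rewrite expr_div_n zN wN divr1.
by apply: contraNneq zw => e; rewrite -[z](divfK w0) e mul1r.
Qed.

(** The eigenvector property [specproj_expmul] turns the polynomial defining
the left factor into its value at z. *)
Lemma specproj_orth z w k (a : 'M[A]_k) :
  z ^+ N = 1 -> w ^+ N = 1 -> a ^+ N.+1 = a ->
  specproj w a *m specproj z a = mxscale (z == w)%:R (specproj z a).
Proof.
move=> zN wN aN; rewrite {1}/specproj mulmx_suml.
rewrite -specproj_coef // mxscale_suml.
by apply: eq_bigr => j _; rewrite mxscaleMl specproj_expmul // mxscaleA.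
Qed.

Lemma specproj_idem z k (a : 'M[A]_k) : z ^+ N = 1 -> a ^+ N.+1 = a ->
  specproj z a ^+ 2 = specproj z a.
Proof.
by move=> zN aN; rewrite expr2 -mulmxE specproj_orth // eqxx mxscale1.
Qed.

Lemma specproj_mxscale z w k (f : 'M[A]_k) :
  z ^+ N = 1 -> w ^+ N = 1 -> f ^+ 2 = f ->
  specproj w (mxscale z f) = mxscale (z == w)%:R f.
Proof.
move=> zN wN ff; rewrite -specproj_coef // mxscale_suml.
by apply: eq_bigr => j _; rewrite mxscale_exp mxscaleA (idem_expS _ ff).
Qed.

(** The defining polynomial is divisible by 'X, so one factor a = uv can be
split off each of its terms. *)
Lemma specproj_sim z k l (a : 'M[A]_k) (b : 'M[A]_l) :
  mx_sim a b -> mx_sim (specproj z a) (specproj z b).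
Proof.
move=> [u [v [ea eb]]].
exists u, (\sum_(j < N) mxscale (N%:R^-1 * z ^- j.+1) (b ^+ j *m v)).
rewrite mulmx_sumr mulmx_suml; split; apply: eq_bigr => j _.
  rewrite mxscaleMr; congr mxscale.
  by rewrite mulmxA eb -mulmxXC -mulmxA -ea mulmxE -exprSr.
by rewrite mxscaleMl -mulmxA -eb mulmxE -exprSr.
Qed.

Lemma specproj_diag z k l (a : 'M[A]_k) (b : 'M[A]_l) :
  specproj z (diagmx a b) = diagmx (specproj z a) (specproj z b).
Proof.
by rewrite -diagmx_sum; apply: eq_bigr => j _; rewrite diagmxX mxscale_diag.
Qed.

Lemma specproj_sum w k (a : 'M[A]_k) : N.-primitive_root w ->
  \sum_(i < N) mxscale (w ^+ i) (specproj (w ^+ i) a) = a.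
Proof.
move=> pw; have wN := prim_expr_order pw; have w0 := unity_root_neq0 wN.
have N0 := prim_order_gt0 pw.
under eq_bigr do rewrite raddf_sum.
(* Only the first power of a survives the sum over i: for 0 < j < N,          *)
(* primitivity makes w ^- j a root of unity other than 1, so the coefficient  *)
(* of a ^+ j.+1 is a vanishing geometric sum.                                 *)
rewrite exchange_big /= (bigD1 (Ordinal N0)) //=.
rewrite [X in _ + X]big1 => [|j j0].
  have {2}<- : mxscale (\sum_(i < N) N%:R^-1) a = a.
    by rewrite sumr_const card_ord -[X in mxscale X]mulr_natr mulVf ?mxscale1.
  rewrite addr0 mxscale_suml; apply: eq_bigr => i _.
  by rewrite mxscaleA !expr1 mulrCA divff ?mulr1 // expf_neq0.
under eq_bigr => i _ do rewrite mxscaleA mulrCA [X in _ * X]mulrC exprS invfM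
  mulrAC mulVf ?expf_neq0 // mul1r -exprM mulnC exprM -exprVn.
rewrite -mxscale_suml -mulr_sumr sum_expr_unity_root ?mulr0 ?mxscale0l //.
  by rewrite exprVn -exprM mulnC exprM wN expr1n invr1.
by rewrite invr_eq1 -(prim_order_dvd pw) gtnNdvd // lt0n.
Qed.

End SpectralProjection.

Lemma map_specproj (K : fieldType) (A B : unitalAlg K)
    (f : {rmorphism A -> B}) N z k (a : 'M[A]_k) :
  alg_linear f -> map_mx f (specproj N z a) = specproj N z (map_mx f a).
Proof.
move=> fl; rewrite raddf_sum; apply: eq_bigr => j _.
by rewrite /= (map_mxscale _ _ fl) map_mxX_pz.
Qed.

(** * Decomposition of K_0^n into copies of K_0 *)

Lemma gdiff_sum (M : nmodType) (I : Type) (s : seq I) (a b : I -> M) :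
  \sum_(i <- s) gdiff (a i) (b i) =
  gdiff (\sum_(i <- s) a i) (\sum_(i <- s) b i).
Proof.
elim: s => [|i s IHs]; first by rewrite !big_nil.
by rewrite !big_cons IHs gdiffD.
Qed.

Section Decomposition.
Variables (K : fieldType) (n : nat) (hn : (2 <= n)%N) (w : K).
Hypothesis w_prim : n.-1.-primitive_root w.

Let n_eq : n = n.-1.+1. Proof. by rewrite (ltn_predK hn). Qed.

Let wX i : (w ^+ i) ^+ n.-1 = 1.
Proof. by rewrite -exprM mulnC exprM (prim_expr_order w_prim) expr1n. Qed.

Let wX_eq (i j : 'I_n.-1) : (w ^+ i == w ^+ j) = (i == j).
Proof. by rewrite (eq_prim_root_expr w_prim) !modn_small. Qed.

Let N_neq0 : n.-1%:R != 0 :> K. Proof. exact: prim_root_natf_neq0 w_prim. Qed.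

Section Algebra.
Variable A : unitalAlg K.

Lemma specproj_potent i k (a : 'M[A]_k) :
  a ^+ n = a -> specproj n.-1 (w ^+ i) a ^+ 2 = specproj n.-1 (w ^+ i) a.
Proof.
by move=> ha; apply: specproj_idem; rewrite ?wX -?n_eq.
Qed.

Definition specproj_op i : potentOp n 2 A A :=
  PotentOp (@specproj_potent i) (@specproj_sim K A n.-1 (w ^+ i))
    (@specproj_diag K A n.-1 (w ^+ i)).

Lemma mxscale_potent i k (f : 'M[A]_k) :
  f ^+ 2 = f -> mxscale (w ^+ i) f ^+ n = mxscale (w ^+ i) f.
Proof. by move=> ff; rewrite mxscale_exp n_eq exprS wX mulr1 idem_expS. Qed.

Lemma mxscale_sim i k l (a : 'M[A]_k) (b : 'M[A]_l) :
  mx_sim a b -> mx_sim (mxscale (w ^+ i) a) (mxscale (w ^+ i) b).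
Proof.
move=> [u [v [-> ->]]]; exists (mxscale (w ^+ i) u), v.
by rewrite mxscaleMl mxscaleMr.
Qed.

Definition scale_op i : potentOp 2 n A A :=
  PotentOp (@mxscale_potent i) (@mxscale_sim i)
    (fun k l => @mxscale_diag K A k l (w ^+ i)).

Lemma V_specproj_scale (i j : 'I_n.-1) (x : Vn (leqnn 2) A) :
  V_op (leqnn 2) (specproj_op j) (V_op hn (scale_op i) x) =
  if i == j then x else 0.
Proof.
have [k [f [hf ->]]] := Vclass_surj x; rewrite !V_opE.
have /= E : specproj n.-1 (w ^+ j) (mxscale (w ^+ i) f) = mxscale (i == j)%:R f.
  by rewrite specproj_mxscale // wX_eq.
case: eqP E => _ E.
  by apply: Vclass_congr; rewrite /= E mxscale1.
by apply: Vclass0; rewrite /= E mxscale0l.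
Qed.

Lemma V_scale_specproj_sum (x : Vn hn A) :
  \sum_(i < n.-1) V_op hn (scale_op i) (V_op (leqnn 2) (specproj_op i) x) = x.
Proof.
have [k [a [ha ->]]] := Vclass_surj x.
under eq_bigr do rewrite !V_opE.
have aN : a ^+ n.-1.+1 = a by rewrite -n_eq.
pose b (i : 'I_n.-1) := mxscale (w ^+ i) (specproj n.-1 (w ^+ i) a).
have hb i : b i ^+ n = b i by apply: mxscale_potent; apply: specproj_potent.
have sb : \sum_i b i = a by apply: specproj_sum.
have hs : (\sum_i b i) ^+ n = \sum_i b i by rewrite sb.
transitivity (Vclass hn (mkpotent hs)); last exact: Vclass_congr.
rewrite (Vclass_orth_sum hn hb hs (index_enum_uniq _)).
  by apply: eq_bigr => i _; apply: Vclass_congr.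
move=> i j ij; rewrite mxscaleMl mxscaleMr specproj_orth //.
by rewrite eq_sym wX_eq (negPf ij) mxscale0l !mxscale0.
Qed.

Definition spectral (x : K0n hn A) : {ffun 'I_n.-1 -> K0 A} :=
  [ffun i : 'I_n.-1 => groth_map (V_op (leqnn 2) (specproj_op i)) x].

Lemma spectral_additive : nmod_morphism spectral.
Proof.
by split=> [|x y]; apply/ffunP => i; rewrite !ffunE ?raddf0 ?raddfD.
Qed.

HB.instance Definition _ := GRing.isNmodMorphism.Build
  (K0n hn A) {ffun 'I_n.-1 -> K0 A} spectral spectral_additive.

Definition spectral_inv (y : {ffun 'I_n.-1 -> K0 A}) : K0n hn A :=
  \sum_(i < n.-1) groth_map (V_op hn (scale_op i)) (y i).

Lemma spectralK : cancel spectral spectral_inv.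
Proof.
move=> x; have [a [b ->]] := gdiff_surj x; rewrite /spectral_inv.
under eq_bigr do rewrite ffunE (groth_mapE _ a b) groth_mapE.
by rewrite gdiff_sum !V_scale_specproj_sum.
Qed.

Lemma spectral_invK : cancel spectral_inv spectral.
Proof.
move=> y; apply/ffunP => j; rewrite ffunE raddf_sum.
rewrite (bigD1 j) //= big1 ?addr0 => [|i ij].
  have [a [b ->]] := gdiff_surj (y j).
  by rewrite (groth_mapE _ a b) groth_mapE /= !V_specproj_scale eqxx.
have [a [b ->]] := gdiff_surj (y i).
by rewrite (groth_mapE _ a b) groth_mapE /= !V_specproj_scale (negPf ij).
Qed.

Lemma spectral_bij : bijective spectral.
Proof. exact: Bijective spectralK spectral_invK. Qed.

End Algebra.

Lemma spectral_natural (A B : unitalAlg K) (f : {rmorphism A -> B}) :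
  alg_linear f -> forall x : K0n hn A,
  spectral (K0n_map hn f x) = [ffun i => K0_map f (spectral x i)].
Proof.
move=> fl x; apply/ffunP => i; have [a [b ->]] := gdiff_surj x.
rewrite !ffunE /K0_map /K0n_map /= !(groth_mapE _ a b) !groth_mapE /=.
have nat_op (y : Vn hn A) : V_map f (V_op (leqnn 2) (specproj_op A i) y) =
    V_op (leqnn 2) (specproj_op B i) (V_map f y).
  by apply: V_map_op => k c; exact: map_specproj.
by rewrite !nat_op.
Qed.

End Decomposition.

(** * Algebras over an algebraically closed field *)

(** Since N is invertible in K, 'X^N - 1 is separable, so it has N distinct
roots in K. *)
Lemma closed_prim_root_exists (K : closedFieldType) N :
  N%:R != 0 :> K -> exists w : K, N.-primitive_root w.
Proof.
move=> N_neq0.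
have N0 : (0 < N)%N by rewrite lt0n; apply: contraNneq N_neq0 => ->.
pose p : {poly K} := 'X^N - 1; have [r Dp] := closed_field_poly_normal p.
rewrite (monicP _) ?monicXnsubC // scale1r in Dp.
have rN1 : all N.-unity_root r.
  by apply/allP=> z; rewrite -root_prod_XsubC -Dp.
have sz_r : (N < (size r).+1)%N.
  by rewrite -(size_prod_XsubC r id) -Dp size_XnsubC.
have ur : uniq r by rewrite -separable_prod_XsubC -Dp separable_Xn_sub_1.
by have /hasP[w _ pw] := has_prim_root N0 rN1 ur sz_r; exists w.
Qed.

Theorem corollary3p14 (R : realType) (n : nat) (hn : (2 <= n)%N) :
  exists phi : forall A : unitalAlg R[i],
      {additive K0n hn A -> {ffun 'I_n.-1 -> K0 A}},
    (forall A : unitalAlg R[i], bijective (phi A)) /\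
    (forall (A B : unitalAlg R[i]) (f : {rmorphism A -> B}),
        alg_linear f ->
        forall x : K0n hn A,
          phi B (K0n_map hn f x) = [ffun i => K0_map f (phi A x i)]).
Proof.
have N_neq0 : n.-1%:R != 0 :> R[i].
  by rewrite Num.Theory.pnatr_eq0 -lt0n -ltnS (ltn_predK hn).
have [w w_prim] : exists w : R[i], n.-1.-primitive_root w :=
  closed_prim_root_exists N_neq0.
exists (fun A => spectral (hn := hn) w_prim (A := A)); split=> [A|A B f fl x].
  exact: spectral_bij.
exact: spectral_natural.
Qed.
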